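(* There exists a countably infinite non-abelian nilpotent group $G$ such that the lattice $\mathcal{L}_G$ of all group topologies on $G$ is modular.
   Context: For a group $G$, $\mathcal{L}_G$ denotes the set of all (not necessarily Hausdorff) group topologies on $G$, i.e. topologies making multiplication and inversion continuous, ordered by inclusion: $\tau\le\sigma$ iff $\tau\subseteq\sigma$ ($\sigma$ is finer than $\tau$). With this order $\mathcal{L}_G$ is a complete lattice; $\vee$ and $\wedge$ denote supremum and infimum in $\mathcal{L}_G$. A lattice $\mathcal{L}$ is modular if $a\vee(b\wedge c)=(a\vee b)\wedge c$ for all $a,b,c\in\mathcal{L}$ with $a\le c$. *)

(* Defs.v *)
From HB Require Import structures.
From mathcomp Require Import all_boot all_order.
From mathcomp Require Import boolp classical_sets functions cardinality topology.

Set Implicit Arguments.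
Unset Strict Implicit.
Unset Printing Implicit Defensive.

Local Open Scope classical_set_scope.
Local Open Scope group_scope.

(* [smallest subgroup_set A] is the subgroup generated by [A]. *)
Definition subgroup_set (G : groupType) (H : set G) : Prop :=
  [/\ H 1, forall x y, H x -> H y -> H (x * y) & forall x, H x -> H x^-1].

Fixpoint lower_central (G : groupType) (n : nat) : set G :=
  if n is m.+1 then
    smallest (@subgroup_set G)
      [set z | exists x y : G, lower_central m x /\ z = [~ x, y]]
  else [set: G].
Arguments lower_central : clear implicits.

Definition nilpotent_group (G : groupType) : Prop :=
  exists n, lower_central G n = [set 1].

Definition abelian_group (G : groupType) : Prop :=
  forall x y : G, commute x y.

(* The empty set is open as the union of the empty family. *)
Record is_topology (T : Type) (op : set (set T)) : Prop := IsTopology {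
  is_topologyT : op [set: T];
  is_topologyI : setI_closed op;
  is_topologyU : forall F : set (set T), F `<=` op -> op (\bigcup_(A in F) A)
}.

(* Carrier alias: [T] equipped with the topology whose open sets are [op]. *)
Definition topologize (T : Type) (op : set (set T)) (_ : is_topology op) : Type
  := T.

Section Topologize.
Variables (T : choiceType) (op : set (set T)) (top : is_topology op).

HB.instance Definition _ := Choice.on (topologize top).

Let opU (I : Type) (f : I -> set T) :
  (forall i, op (f i)) -> op (\bigcup_i f i).
Proof.
move=> fop; have -> : \bigcup_i f i = \bigcup_(A in range f) A.
  by rewrite bigcup_image.
by apply: is_topologyU => // _ [i _ <-].
Qed.

HB.instance Definition _ := isOpenTopological.Build (topologize top)
  (is_topologyT top) (is_topologyI top) opU.

Lemma open_topologize (A : set (topologize top)) : open A = op A.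
Proof. by []. Qed.

End Topologize.

Definition continuous_mul (G : groupType) (op : set (set G))
    (top : is_topology op) : Prop :=
  continuous (fun p : (topologize top * topologize top)%type =>
    ((p.1 : G) * (p.2 : G) : topologize top)).

Definition continuous_inv (G : groupType) (op : set (set G))
    (top : is_topology op) : Prop :=
  continuous (fun x : topologize top => ((x : G)^-1 : topologize top)).

Record group_topology (G : groupType) := GroupTopology {
  opens : set (set G);
  opens_topology : is_topology opens;
  opens_mul : continuous_mul opens_topology;
  opens_inv : continuous_inv opens_topology
}.

Lemma group_topology_inj (G : groupType) : injective (@opens G).
Proof.
case=> [o1 t1 m1 i1] [o2 t2 m2 i2] /= e; subst o2.
have et : t1 = t2 by exact: Prop_irrelevance.
subst t2; congr GroupTopology; exact: Prop_irrelevance.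
Qed.

Section Supremum.
Variables (G : groupType) (S : set (group_topology G)).

Definition sup_opens : set (set G) :=
  smallest (@is_topology G) (\bigcup_(t in S) opens t).

Lemma sup_opens_topology : is_topology sup_opens.
Proof.
split=> [M [Mtop _]|A B SA SB M MS|F FS M MS].
- exact: is_topologyT.
- by apply: (is_topologyI MS.1); [exact: SA|exact: SB].
- by apply: (is_topologyU MS.1) => A /FS; apply.
Qed.

Let supG := topologize sup_opens_topology.

Let sub_sup (t : group_topology G) : S t -> opens t `<=` sup_opens.
Proof. by move=> St A tA M [_]; apply; exists t. Qed.

(* A map into the generated topology is continuous as soon as the preimages of
   the sets of the subbase are open. *)
Let continuous_to_sup (X : topologicalType) (f : X -> supG) :
  (forall t A, S t -> opens t A -> open (f @^-1` A)) -> continuous f.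
Proof.
move=> fo; apply/continuousP => A SA.
apply: (SA [set B : set G | open (f @^-1` B)]); split; last first.
  by move=> B [t St tB]; exact: fo St tB.
split=> [|B C|F Fo].
- by rewrite /= preimage_setT; exact: openT.
- by rewrite /= preimage_setI; exact: openI.
- by rewrite /= preimage_bigcup; apply: bigcup_open => B /Fo.
Qed.

Lemma sup_opens_mul : continuous_mul sup_opens_topology.
Proof.
apply: continuous_to_sup => t A St tA.
have /continuousP/(_ A tA) := @opens_mul G t.
rewrite !openE => h p /h [[B C] [/= Bp Cp] BC].
exists (B, C) => //=; split.
- by case: Bp => D [oD Dp DB]; exists D; split => //; exact: sub_sup oD.
- by case: Cp => D [oD Dp DB]; exists D; split => //; exact: sub_sup oD.
Qed.

Lemma sup_opens_inv : continuous_inv sup_opens_topology.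
Proof.
apply: continuous_to_sup => t A St tA.
have /continuousP/(_ A tA) h := @opens_inv G t.
exact: (sub_sup St h).
Qed.

Definition sup_group_topology : group_topology G :=
  GroupTopology sup_opens_mul sup_opens_inv.

Lemma sup_group_topology_ub (t : group_topology G) :
  S t -> opens t `<=` opens sup_group_topology.
Proof. exact: sub_sup. Qed.

Lemma sup_group_topology_le (u : group_topology G) :
  (forall t, S t -> opens t `<=` opens u) ->
  opens sup_group_topology `<=` opens u.
Proof.
move=> Su A; apply; split; first exact: opens_topology.
by move=> B [t St tB]; exact: Su St _ tB.
Qed.

End Supremum.

HB.instance Definition _ (G : groupType) := gen_eqMixin (group_topology G).
HB.instance Definition _ (G : groupType) := gen_choiceMixin (group_topology G).

Fact group_topology_display : Order.disp_t.
Proof. exact: Order.Disp tt tt. Qed.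

Section Lattice.
Variable G : groupType.
Implicit Types s t u : group_topology G.

Definition gt_le s t : bool := `[< opens s `<=` opens t >].
Definition gt_join s t := sup_group_topology [set s; t].
(* The intersection of two group topologies need not be a group topology. *)
Definition gt_meet s t := sup_group_topology
  [set u | opens u `<=` opens s /\ opens u `<=` opens t].

Let le_refl : reflexive gt_le.
Proof. by move=> s; apply/asboolP. Qed.

Let le_anti : antisymmetric gt_le.
Proof.
move=> s t /andP[/asboolP st /asboolP ts].
by apply: group_topology_inj; apply/seteqP.
Qed.

Let le_trans : transitive gt_le.
Proof.
by move=> t s u /asboolP st /asboolP tu; apply/asboolP; exact: subset_trans tu.
Qed.

HB.instance Definition _ := Order.Le_isPOrder.Build group_topology_display
  (group_topology G) le_refl le_anti le_trans.

Let leI u s t : gt_le u (gt_meet s t) = gt_le u s && gt_le u t.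
Proof.
apply/asboolP/andP => [le|[/asboolP us /asboolP ut]]; last first.
  exact: sup_group_topology_ub.
by split; apply/asboolP; apply: (subset_trans le);
  apply: sup_group_topology_le => v [].
Qed.

Let leU s t u : gt_le (gt_join s t) u = gt_le s u && gt_le t u.
Proof.
apply/asboolP/andP => [le|[/asboolP su /asboolP tu]]; last first.
  by apply: sup_group_topology_le => v [] ->.
split; apply/asboolP; apply: (subset_trans _ le);
  apply: sup_group_topology_ub; by [left|right].
Qed.

HB.instance Definition _ := Order.POrder_isMeetSemilattice.Build
  group_topology_display (group_topology G) leI.
HB.instance Definition _ := Order.POrder_isJoinSemilattice.Build
  group_topology_display (group_topology G) leU.

End Lattice.

Definition modular d (L : latticeType d) : Prop :=
  forall a b c : L, (a <= c -> a `|` (b `&` c) = (a `|` b) `&` c)%O.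

(* Main.v *)
Require Import Defs.
From HB Require Import structures.
From mathcomp Require Import all_boot all_order.
From mathcomp Require Import ssralg ssrint.
From mathcomp Require Import boolp classical_sets functions cardinality topology.

(** The group is D8 x Z, the product of the dihedral group of order 8 and an
    infinite cyclic group.

    In any group, two group topologies s and t permute when the sets U * V (U an
    s-neighbourhood and V a t-neighbourhood of 1) are the neighbourhoods of 1
    for a group topology.  That topology lies below both s and t, and once all
    pairs permute it gives the modular law by the argument used for normal
    subgroups: if a <= c and x = v * w is small for a, with v small for b and w
    small for c, then w is small for a too, so v = x * w^-1 is small for a and b
    ([permute_modular]).  The only obstacle to permuting is that v * u must be
    rewritten as u1 * v1, that is, the commutator of u and v must be absorbed.

    This is possible when the commutators of G take a single nontrivial value c
    and the centre is the centraliser of a finite set.  Either c belongs to all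
    s-neighbourhoods of 1, which then absorb it; or some s-neighbourhood misses
    c, and then, for every g, continuity of x |-> [~ x, g] forces all x
    close to 1 to commute with g.  Applying this to finitely many g shows that
    the elements close to 1 are central ([nbhs1_centre]).  In both cases s
    and t permute ([small_derived_permute]).

    In D8 x Z the commutators are 1 and the central involution of D8, and two
    generators of D8 detect the centre. *)

Set Implicit Arguments.
Unset Strict Implicit.
Unset Printing Implicit Defensive.

Import Order.LTheory.

Local Open Scope classical_set_scope.
Local Open Scope group_scope.

(** * Neighbourhoods of the identity *)

Section GroupTopologies.
Variable G : groupType.
Implicit Types (s t : group_topology G) (A B : set G) (x y g : G).

(** The type is convertible to [G]; its only role is to select the topology
    [t] when continuity and neighbourhoods are inferred. *)
Definition carrier t : topologicalType := topologize (opens_topology t).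

Definition nbhs1 t : set_system G := nbhs (1 : carrier t).

#[local] Instance nbhs1_filter t : ProperFilter (nbhs1 t).
Proof. exact: (@nbhs_pfilter (carrier t)). Qed.

Lemma mem_nbhs1 t A : nbhs1 t A -> A 1.
Proof. exact: (@nbhs_singleton (carrier t)). Qed.

Lemma continuousM t (X : topologicalType) (f h : X -> carrier t) :
  continuous f -> continuous h ->
  continuous (fun x : X => (f x : G) * (h x : G) : carrier t).
Proof.
move=> cf ch x; apply: (@cvg_comp _ _ _ (fun x : X => (f x, h x)) _ _ _ _
  (cvg_pair (cf x) (ch x)) (@opens_mul G t (f x, h x))).
Qed.

Lemma continuousV t (X : topologicalType) (f : X -> carrier t) :
  continuous f -> continuous (fun x : X => (f x : G)^-1 : carrier t).
Proof.
move=> cf x; exact: (@cvg_comp _ _ _ f _ _ _ _ (cf x) (@opens_inv G t (f x))).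
Qed.

Lemma continuousMl t x : continuous (fun y : carrier t => x * y : carrier t).
Proof. by apply: continuousM => y; [exact: cst_continuous|exact: cvg_id]. Qed.

Lemma nbhs_translate t x A :
  nbhs (x : carrier t) A <-> nbhs1 t [set y | A (x * y)].
Proof.
split=> nA; first by apply: (@continuousMl t x 1); rewrite mulg1.
have /filterS : nbhs (x : carrier t) [set z | A (x * (x^-1 * z))].
  apply: (@continuousMl t x^-1 x [set y | A (x * y)]).
  by have -> : x^-1 * x = 1 by rewrite mulVg.
by apply=> z /=; rewrite mulVKg.
Qed.

(** A group topology is determined by its neighbourhoods of 1, since left
    translations are homeomorphisms. *)
Lemma opens_nbhs1 t A :
  opens t A <-> forall x, A x -> nbhs1 t [set y | A (x * y)].
Proof.
have -> : opens t A = open (A : set (carrier t)) by [].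
rewrite openE; split=> h x Ax; first by move: (h x Ax) => /nbhs_translate.
by rewrite /interior; apply/nbhs_translate; exact: h.
Qed.

Lemma opens_sub s t :
  (opens s `<=` opens t) <-> (nbhs1 s `<=` nbhs1 t).
Proof.
split=> [st A [B [sB B1 BA]]|st A /opens_nbhs1 h].
  by exists B; split=> //; exact: st.
by apply/opens_nbhs1 => x /h /st.
Qed.

Lemma nbhs1M t A : nbhs1 t A ->
  exists2 B, nbhs1 t B & forall x y, B x -> B y -> A (x * y).
Proof.
move=> tA; have /(@opens_mul G t (1, 1)) : nbhs (1 * 1 : carrier t) A.
  by rewrite (mulg1 (1 : G)).
move=> [[B C] [/= tB tC] BCA]; exists (B `&` C); first exact: filterI.
by move=> x y [Bx _] [_ Cy]; exact: (BCA (x, y)).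
Qed.

Lemma nbhs1V t A : nbhs1 t A -> nbhs1 t [set x | A x^-1].
Proof. by move=> tA; apply: (@opens_inv G t 1); rewrite invg1. Qed.

Lemma nbhs1J t g A : nbhs1 t A -> nbhs1 t [set x | A (x ^ g)].
Proof.
move=> tA; suff : continuous (fun x : carrier t => (x : G) ^ g : carrier t).
  by apply; rewrite conj1g.
apply: continuousM; first exact: cst_continuous.
by apply: continuousM => y; [exact: cvg_id|exact: cst_continuous].
Qed.

Lemma nbhs1R t g A : nbhs1 t A -> nbhs1 t [set x | A [~ x, g]].
Proof.
move=> /nbhs1M[B tB BA].
apply: filterS (filterI (nbhs1V tB) (nbhs1J g tB)) => x [Bx Bxg].
exact: BA.
Qed.

(** * The group topology defined by a filter *)

(** These closure conditions characterise the filters of neighbourhoods of 1: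
    every such filter is [nbhs1] of a group topology, by
    [nbhs1_filter_topology]. *)
Record group_filter (F : set_system G) : Prop := GroupFilter {
  group_filter_filter : Filter F;
  group_filter1 : forall A, F A -> A 1;
  group_filterM : forall A, F A ->
    exists2 B, F B & forall x y, B x -> B y -> A (x * y);
  group_filterV : forall A, F A -> F [set x | A x^-1];
  group_filterJ : forall g A, F A -> F [set x | A (x ^ g)]
}.

Section FilterTopology.
Variables (F : set_system G) (gF : group_filter F).
#[local] Instance F_filter : Filter F := group_filter_filter gF.

Definition filter_opens : set (set G) :=
  [set A | forall x, A x -> F [set y | A (x * y)]].

Lemma filter_opens_topology : is_topology filter_opens.
Proof.
split=> [x _|A B oA oB x [Ax Bx]|S So x [A SA Ax]].
- exact: filterT.
- exact: filterI (oA x Ax) (oB x Bx).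
- by apply: filterS (So A SA x Ax) => y Axy; exists A.
Qed.

Local Notation T := (topologize filter_opens_topology).

(** The points of which [A] is an F-neighbourhood form an open set, because
    [group_filterM] lets a member of [F] be halved. *)
Lemma filter_topology_nbhs x A :
  nbhs (x : T) A <-> F [set y | A (x * y)].
Proof.
split=> [[B [oB Bx BA]]|FA].
  by apply: filterS (oB x Bx) => y; exact: BA.
exists [set z | F [set y | A (z * y)]]; split=> //.
  move=> z /(group_filterM gF)[B FB BA]; apply: filterS (FB) => y By /=; apply: filterS FB => w Bw.
  by rewrite /= -mulgA; exact: BA.
by move=> z /(group_filter1 gF); rewrite /= mulg1.
Qed.

Lemma filter_opens_mul : continuous_mul filter_opens_topology.
Proof.
move=> [x y] A /filter_topology_nbhs /(group_filterM gF)[B FB BA] /=.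
(* (x * u) * (y * v) = (x * y) * (u ^ y * v): the left factor has to be chosen
   so that the conjugate of its displacement is small. *)
exists ([set p | B ((x^-1 * p) ^ y)], [set q | B (y^-1 * q)]); last first.
  move=> [p q] [/= /BA Bp /Bp]; rewrite /= conjgE.
  by rewrite -!mulgA !mulVKg.
split; apply/filter_topology_nbhs => /=.
  by apply: filterS (group_filterJ gF y FB) => u /=; rewrite mulKg.
by apply: filterS FB => u /=; rewrite mulKg.
Qed.

Lemma filter_opens_inv : continuous_inv filter_opens_topology.
Proof.
move=> x A /filter_topology_nbhs FA; apply/filter_topology_nbhs.
apply: filterS (group_filterV gF (group_filterJ gF x^-1 FA)) => u /=.
by rewrite conjgE invgK mulKg invgM.
Qed.

Definition filter_topology : group_topology G :=
  GroupTopology filter_opens_mul filter_opens_inv.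

Lemma nbhs1_filter_topology : nbhs1 filter_topology = F.
Proof.
by apply/seteqP; split=> A; rewrite /nbhs1 filter_topology_nbhs;
  apply: filterS => y; rewrite /= mul1g.
Qed.

End FilterTopology.

(** * Permuting topologies and modularity *)

(** The sets that contain an intersection of an [s]-open and a [t]-open
    neighbourhood around each of their points form a topology finer than [s]
    and [t], hence finer than the generated one. *)
Lemma nbhs1_join s t A : nbhs1 (gt_join s t) A ->
  exists U V, [/\ nbhs1 s U, nbhs1 t V & U `&` V `<=` A].
Proof.
move=> [O [joinO O1 OA]].
pose local_meet (B : set G) := forall x, B x -> exists U V,
  [/\ opens s U /\ U x, opens t V /\ V x & U `&` V `<=` B].
have [] := joinO local_meet _ 1 O1; last first.
  move=> U [V [[sU U1] [tV V1] UVO]]; exists U, V; split.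
  - by exists U; split.
  - by exists V; split.
  - exact: subset_trans OA.
split.
- split=> [x _|B C hB hC x [/hB Bx /hC Cx]|S hS x [B SB /(hS B SB) Bx]].
  + by exists setT, setT; split=> //; split=> //;
      apply: is_topologyT; exact: opens_topology.
  + move: Bx Cx => [U [V [[sU Ux] [tV Vx] UVB]]].
    move=> [U' [V' [[sU' Ux'] [tV' Vx'] UVC]]].
    exists (U `&` U'), (V `&` V'); split.
    * by split=> //; exact: (is_topologyI (opens_topology s)).
    * by split=> //; exact: (is_topologyI (opens_topology t)).
    * by move=> y [[? ?] [? ?]]; split; [exact: UVB|exact: UVC].
  + move: Bx => [U [V [sU tV UVB]]]; exists U, V; split=> //.
    by move=> y /UVB; exists B.
- have openT (r : group_topology G) : opens r setT.
    exact: (is_topologyT (opens_topology r)).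
  move=> B [r [->|->] rB] x Bx.
  + by exists B, setT; split=> // y [].
  + by exists setT, B; split=> // y [].
Qed.

(** This is [V' * U' `<=` U * V] elementwise; it makes the filter generated by the
    sets [U * V] stable under products and inverses. *)
Definition permute s t := forall U V, nbhs1 s U -> nbhs1 t V ->
  exists U' V', [/\ nbhs1 s U', nbhs1 t V' &
    forall u v, U' u -> V' v -> exists u1 v1, [/\ U u1, V v1 & v * u = u1 * v1]].

Definition nbhs1_prod s t : set_system G :=
  [set A | exists U V, [/\ nbhs1 s U, nbhs1 t V &
    forall u v, U u -> V v -> A (u * v)]].

Lemma nbhs1_prodl s t A : nbhs1_prod s t A -> nbhs1 s A.
Proof.
move=> [U [V [sU tV UVA]]]; apply: filterS sU => u Uu.
by rewrite -[u]mulg1; apply: UVA => //; exact: mem_nbhs1 tV.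
Qed.

Lemma nbhs1_prodr s t A : nbhs1_prod s t A -> nbhs1 t A.
Proof.
move=> [U [V [sU tV UVA]]]; apply: filterS tV => v Vv.
by rewrite -[v]mul1g; apply: UVA => //; exact: mem_nbhs1 sU.
Qed.

Lemma nbhs1_prod_group_filter s t : permute s t -> group_filter (nbhs1_prod s t).
Proof.
move=> pst; split.
- split.
  + by exists setT, setT; split=> //; exact: filterT.
  + move=> A B [U [V [sU tV UVA]]] [U' [V' [sU' tV' UVB]]].
    exists (U `&` U'), (V `&` V'); split; try exact: filterI.
    by move=> u v [? ?] [? ?]; split; [exact: UVA|exact: UVB].
  + move=> A B AB [U [V [sU tV UVA]]]; exists U, V; split=> // u v Uu Vv.
    exact/AB/UVA.
- by move=> A /nbhs1_prodl /mem_nbhs1.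
- move=> A [U [V [/nbhs1M[U1 sU1 U1U] /nbhs1M[V1 tV1 V1V] UVA]]].
  have [U2 [V2 [sU2 tV2 U2V2]]] := pst _ _ sU1 tV1.
  exists [set z | exists u v, [/\ (U1 `&` U2) u, (V1 `&` V2) v & z = u * v]].
    exists (U1 `&` U2), (V1 `&` V2); split; try exact: filterI.
    by move=> u v Uu Vv; exists u, v.
  move=> _ _ [u [v [[Uu _] [_ Vv] ->]]] [u' [v' [[_ Uu'] [Vv' _] ->]]].
  have [u1 [v1 [Uu1 Vv1 vu]]] := U2V2 u' v Uu' Vv.
  (* Only the middle factor v * u' is out of order. *)
  have -> : u * v * (u' * v') = (u * u1) * (v1 * v').
    by rewrite !mulgA -(mulgA u v u') vu !mulgA.
  by apply: UVA; [exact: U1U|exact: V1V].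
- move=> A [U [V [sU tV UVA]]].
  have [U2 [V2 [sU2 tV2 U2V2]]] := pst _ _ sU tV.
  exists [set u | U2 u^-1], [set v | V2 v^-1]; split; try exact: nbhs1V.
  move=> u v /U2V2 uV /uV [u1 [v1 [Uu1 Vv1]]]; rewrite /= invgM => ->.
  exact: UVA.
- move=> g A [U [V [sU tV UVA]]].
  exists [set u | U (u ^ g)], [set v | V (v ^ g)]; split; try exact: nbhs1J.
  by move=> u v Uu Vv; rewrite /= conjMg; exact: UVA.
Qed.

(** Only [(a \/ b) /\ c <= a \/ (b /\ c)] needs an argument.  The topology [d]
    whose neighbourhoods of 1 are the products of [b]- and [c]-neighbourhoods
    lies below [b /\ c] and has an explicit description, so it replaces
    [b /\ c].  A neighbourhood [A] for the left side contains [E * E] where [E]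
    is a neighbourhood both for [c] and for [a \/ b]; an element [v * w] of a
    basic [d]-neighbourhood that is also close to 1 for [a] has [w] in [E] and,
    as [a <= c] makes [w] close to 1 for [a], also [v] in [E]. *)
Lemma permute_modular :
  (forall s t : group_topology G, permute s t) -> modular (group_topology G).
Proof.
move=> perm a b c ac; apply: le_anti; apply/andP; split.
  by rewrite lexI !leUx ac leUl leIr !andbT /= (le_trans (leIl _ _) (leUr _ _)).
have : ((a `|` b) `&` c <= a `|` b)%O by exact: leIl.
have : ((a `|` b) `&` c <= c)%O by exact: leIr.
move: ((a `|` b) `&` c)%O => e ec eab.
pose d := filter_topology (nbhs1_prod_group_filter (perm b c)).
have dbc : (d <= Order.meet b c)%O.
  rewrite lexI; apply/andP; split; apply/asboolP/opens_sub;
    rewrite nbhs1_filter_topology => A; [exact: nbhs1_prodl|exact: nbhs1_prodr].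
suff ead : (e <= Order.join a d)%O.
  apply: le_trans ead _.
  by rewrite leU2.
move: ec eab ac => /asboolP/opens_sub ec /asboolP/opens_sub eab /asboolP/opens_sub ac.
apply/asboolP/opens_sub => A /nbhs1M[E eE EA].
have [U [V [/nbhs1M[U1 aU1 U1U] bV UVE]]] := nbhs1_join (eab _ eE).
pose W := [set w | U1 w^-1] `&` E.
have cW : nbhs1 c W by apply: filterI; [exact/nbhs1V/ac|exact: ec].
have jU1 : nbhs1 (Order.join a d) U1.
  have /asboolP/opens_sub h : (a <= Order.join a d)%O.
    exact: leUl.
  exact: h.
have jVW : nbhs1 (Order.join a d) [set x | exists v w, [/\ V v, W w & x = v * w]].
  have /asboolP/opens_sub h : (d <= Order.join a d)%O.
    exact: leUr.
  apply: h; rewrite nbhs1_filter_topology; exists V, W; split=> // v w Vv Ww.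
  by exists v, w.
apply: filterS (filterI jU1 jVW) => x [U1x [v [w [Vv [U1w Ew] xE]]]].
rewrite xE; apply: EA => //; apply: UVE; split=> //.
by rewrite -(mulgK w v) -xE; exact: U1U.
Qed.

(** * Groups with a single nontrivial commutator *)

Section SmallDerived.
Variables (c : G) (s : seq G).
Hypothesis commutator_c : forall x y, [~ x, y] = 1 \/ [~ x, y] = c.
Hypothesis centre_s :
  forall x, (forall y, y \in s -> commute x y) -> forall y, commute x y.

(** For fixed [g] the map [x |-> [~ x, g]] is continuous and sends 1 to 1, so
    near 1 it avoids the value [c] and is therefore trivial; finitely many [g]
    suffice to conclude that [x] is central. *)
Lemma nbhs1_centre t A : nbhs1 t A -> ~ A c ->
  nbhs1 t [set x | forall y, commute x y].
Proof.
move=> tA Ac; have : nbhs1 t [set x | forall y, y \in s -> commute x y].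
  elim: s => [|g r IHr]; first by apply: filterS filterT.
  apply: filterS (filterI (nbhs1R g tA) IHr) => x [xg xr] y.
  rewrite inE => /orP[/eqP ->|/xr //]; apply/commgP/eqP.
  by case: (commutator_c x g) => // xgc; case: Ac; rewrite -xgc.
by apply: filterS => x /centre_s.
Qed.

(** Either the elements small for [t] are central and commute with everything,
    or the [t]-neighbourhoods of 1 are closed, up to shrinking, under left
    multiplication by commutators. *)
Lemma small_derived_permute t u : permute t u.
Proof.
move=> U V tU uV.
have [tc|] := pselect (forall A, nbhs1 t A -> A c); last first.
  move=> /existsNP[A /not_implyP[tA Ac]].
  exists (U `&` [set x | forall y, commute x y]), V; split=> //.
    by apply: filterI => //; exact: nbhs1_centre Ac.
  by move=> x y [Ux xC] Vy; exists x, y; split=> //; exact: esym (xC y).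
have [U1 tU1 U1U] := nbhs1M tU.
exists U1, V; split=> // x y U1x Vy; rewrite commgCV mulgA.
exists ([~ y^-1, x^-1] * x), y; split=> //; apply: U1U => //.
by case: (commutator_c y^-1 x^-1) => ->; [exact: mem_nbhs1 tU1|exact: tc].
Qed.

Lemma small_derived_modular : modular (group_topology G).
Proof. exact/permute_modular/small_derived_permute. Qed.

End SmallDerived.
End GroupTopologies.

(** * The group D8 x Z *)

Lemma class2_nilpotent (G : groupType) :
  (forall x y z : G, commute [~ x, y] z) -> nilpotent_group G.
Proof.
move=> cR; exists 2; apply/seteqP; split=> [x|_ ->]; last first.
  by move=> H [[H1 _ _] _].
have lc1 : lower_central G 1 `<=` [set x | forall y, commute x y].
  move=> y /(_ [set x | forall y, commute x y]); apply.
  split=> [|_ [u [v [_ ->]]]]; last exact: cR.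
  split=> [z|u v uC vC z|u uC z]; apply: commute_sym.
  - exact: commute1.
  - by apply: commuteM; apply: commute_sym.
  - by apply: commuteV; apply: commute_sym.
move=> /(_ [set 1]); apply; split=> [|_ [u [v [/lc1 uC ->]]]].
  by split=> [//|_ _ -> ->|_ ->]; rewrite /= ?mulg1 ?invg1.
by apply/eqP/commgP.
Qed.

(** [(z, x, y, n)] stands for the pair of the unitriangular matrix with rows
    [1 x z], [0 1 y], [0 0 1] over the field with two elements (such matrices
    form a dihedral group of order 8) and the integer [n]. *)
Definition D8Z : Type := (bool * bool * bool * int)%type.

HB.instance Definition _ := Countable.on D8Z.

Section D8Z.
Implicit Types p q : D8Z.

Definition D8Z_one : D8Z := (false, false, false, 0%R).

Definition D8Z_mul p q : D8Z :=
  let: (z, x, y, n) := p in let: (z', x', y', n') := q in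
  (z (+) z' (+) (x && y'), x (+) x', y (+) y', (n + n')%R).

Definition D8Z_inv p : D8Z :=
  let: (z, x, y, n) := p in (z (+) (x && y), x, y, (- n)%R).

Lemma D8Z_mulA : associative D8Z_mul.
Proof.
move=> [[[z x] y] n] [[[z' x'] y'] n'] [[[z'' x''] y''] n''] /=.
rewrite GRing.addrA; congr (_, _, _, _); rewrite ?addbA //.
by case: x x' y' y'' => [] [] [] []; case: z z' z'' => [] [] [].
Qed.

Lemma D8Z_mul1 : left_id D8Z_one D8Z_mul.
Proof. by move=> [[[z x] y] n]; rewrite /= GRing.add0r addbF. Qed.

Lemma D8Z_mulr1 : right_id D8Z_one D8Z_mul.
Proof. by move=> [[[z x] y] n]; rewrite /= GRing.addr0 andbF !addbF. Qed.

Lemma D8Z_mulV : left_inverse D8Z_one D8Z_inv D8Z_mul.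
Proof.
by move=> [[[z x] y] n]; rewrite /= GRing.addNr; case: z x y => [] [] [].
Qed.

Lemma D8Z_mulrV : right_inverse D8Z_one D8Z_inv D8Z_mul.
Proof.
by move=> [[[z x] y] n]; rewrite /= GRing.addrN; case: z x y => [] [] [].
Qed.

End D8Z.

HB.instance Definition _ := isGroup.Build D8Z
  D8Z_mulA D8Z_mul1 D8Z_mulr1 D8Z_mulV D8Z_mulrV.

Lemma D8Z_mulE (z x y z' x' y' : bool) (n n' : int) :
  ((z, x, y, n) : D8Z) * (z', x', y', n') =
  (z (+) z' (+) (x && y'), x (+) x', y (+) y', (n + n')%R) :> D8Z.
Proof. by []. Qed.

(** Two elements commute when the determinant [x * y' - x' * y] vanishes mod 2. *)
Lemma D8Z_commuteP (z x y z' x' y' : bool) (n n' : int) :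
  commute ((z, x, y, n) : D8Z) (z', x', y', n') <-> x && y' = x' && y.
Proof.
rewrite /commute !D8Z_mulE (addbC z) (addbC x) (addbC y) (GRing.addrC n).
by split=> [[/addbI]|->].
Qed.

Definition D8Z_c : D8Z := (true, false, false, 0%R).

Lemma D8Z_commutator (p q : D8Z) : [~ p, q] = 1 \/ [~ p, q] = D8Z_c.
Proof.
suff [b] : exists b, q * p * ((b, false, false, 0%R) : D8Z) = p * q.
  by rewrite (commgC p) => /mulgI <-; case: b; [right|left].
move: p q => [[[z x] y] n] [[[z' x'] y'] n'].
exists ((x && y') (+) (x' && y)); rewrite !D8Z_mulE !GRing.addr0.
congr (_, _, _, _); last exact: GRing.addrC; rewrite ?addbF; last 2 first.
- exact: addbC.
- exact: addbC.
by rewrite andbF; case: x x' y y' z z' => [] [] [] [] [] [].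
Qed.

Lemma D8Z_central_c (p : D8Z) : commute D8Z_c p.
Proof. by move: p => [[[z x] y] n]; apply/D8Z_commuteP; rewrite andbF. Qed.

Definition D8Z_gens : seq D8Z :=
  [:: (false, true, false, 0%R); (false, false, true, 0%R)].

Lemma D8Z_centre (p : D8Z) :
  (forall q, q \in D8Z_gens -> commute p q) -> forall q, commute p q.
Proof.
move: p => [[[z x] y] n] pC [[[z' x'] y'] n']; apply/D8Z_commuteP.
have /D8Z_commuteP : commute ((z, x, y, n) : D8Z) (false, true, false, 0%R).
  by apply: pC; rewrite inE eqxx.
have /D8Z_commuteP : commute ((z, x, y, n) : D8Z) (false, false, true, 0%R).
  by apply: pC; rewrite !inE eqxx orbT.
by rewrite andbT andbF /= => -> <-; rewrite andbF.
Qed.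

Lemma D8Z_card : ([set: D8Z] #= [set: nat])%card.
Proof.
pose f (n : nat) : D8Z := (false, false, false, n%:Z%R).
have f_inj : {in [set: nat] &, injective f} by move=> m n _ _ [].
rewrite card_eq_le; apply/andP; split; first exact: countableP.
by rewrite -(card_le_eql (inj_card_eq f_inj)) subset_card_le.
Qed.

Theorem theorem1p1 :
  exists G : groupType,
    [/\ ([set: G] #= [set: nat])%card,
        ~ abelian_group G,
        nilpotent_group G
      & modular (group_topology G)].
Proof.
exists (D8Z : groupType); split.
- exact: D8Z_card.
- by move=> /(_ (false, true, false, 0%R) (false, false, true, 0%R)) /D8Z_commuteP.
- apply: class2_nilpotent => x y z.
  case: (D8Z_commutator x y) => ->; last exact: D8Z_central_c.
  exact/commute_sym/commute1.
- exact: (small_derived_modular D8Z_commutator D8Z_centre).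
Qed.
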